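(* For every nonnegative integer $n$, $$pod(n)=\sum_{j=0}^{\infty}A(j)\,\overline{p}(n-j).$$
   Context: $pod(n)$ denotes the number of partitions of $n$ in which odd parts are distinct and even parts may be repeated, with $pod(0)=1$. An overpartition of $n$ is a non-increasing sequence of positive integers with sum $n$ in which the first occurrence of each number may be overlined; $\overline{p}(n)$ is the number of overpartitions of $n$, with $\overline{p}(0)=1$ and $\overline{p}(m)=0$ for $m<0$. Let $a_e(n)$ (respectively $a_o(n)$) be the number of partitions of $n$ into an even (respectively odd) number of parts in which the even parts can appear in two colours, and let $A(n)=a_e(n)-a_o(n)$, with $A(0)=1$. The generating function is $\sum_{n\ge0}A(n)q^n=\prod_{k\ge1}\frac{1}{(1+q^k)(1+q^{2k})}$. *)

(* Defs.v *)
From mathcomp Require Import all_boot all_order all_algebra.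

Set Implicit Arguments.
Unset Strict Implicit.
Unset Printing Implicit Defensive.

Definition is_partition (n : nat) (s : seq nat) : bool :=
  [&& sorted geq s, all (ltn 0) s & sumn s == n].

Definition is_pod_partition (n : nat) (s : seq nat) : bool :=
  is_partition n s && uniq [seq k <- s | odd k].

(* A partition of n has at most n parts, each at most n, so the counts below
   range over sequences of length at most n with entries in {0, ..., n}. *)
Definition pod (n : nat) : nat :=
  #|[set s : {bseq n of 'I_n.+1} | is_pod_partition n [seq val x | x <- s]]|.

(* An entry (k, b) is the part k, overlined when b = true. *)
Definition is_overpartition (n : nat) (s : seq (nat * bool)) : bool :=
  is_partition n (unzip1 s) &&
  [forall i : 'I_(size s),
     (nth false (unzip2 s) i) ==>
       (index (nth 0 (unzip1 s) i) (unzip1 s) == i)].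

Definition overp (m : int) : nat :=
  if m is Posz n then
    #|[set s : {bseq n of 'I_n.+1 * bool} |
        is_overpartition n [seq (val x.1, x.2) | x <- s]]|
  else 0.

(* The order on coloured parts (k, c): by size, then by colour.  A partition
   into coloured parts is a multiset of them, and is represented by its unique
   non-increasing arrangement. *)
Definition cgeq (x y : nat * bool) : bool :=
  (y.1 < x.1) || ((y.1 == x.1) && (y.2 <= x.2)).

(* Odd parts come only in the colour false, even parts in both colours. *)
Definition is_coloured_partition (n : nat) (s : seq (nat * bool)) : bool :=
  [&& sorted cgeq s, is_partition n (unzip1 s) &
      all (fun x => odd x.1 ==> ~~ x.2) s].

Definition a_even (n : nat) : nat :=
  #|[set s : {bseq n of 'I_n.+1 * bool} |
      is_coloured_partition n [seq (val x.1, x.2) | x <- s] &&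
      ~~ odd (size s)]|.

Definition a_odd (n : nat) : nat :=
  #|[set s : {bseq n of 'I_n.+1 * bool} |
      is_coloured_partition n [seq (val x.1, x.2) | x <- s] &&
      odd (size s)]|.

Definition A (n : nat) : int := ((a_even n)%:Z - (a_odd n)%:Z)%R.

(* Main.v *)
(** Encoding parts as natural numbers, each of the three kinds of partitions is
    a non-increasing word in which every letter has a bounded multiplicity, so
    its generating function is a product of geometric sums.  Modulo X^(N+1),
    multiplying both sides of the identity by
    [\prod_k (1 - X^k) * \prod_(k even) (1 + X^k)] turns the right-hand side into
    1 and the left-hand side into
    [\prod_(k odd) (1 - X^(2 k)) * \prod_(k even) (1 + X^k)], which is 1 by Euler's
    theorem on odd and distinct parts, taken in the variable X^2. *)
Require Import Defs.
From mathcomp Require Import all_boot all_order all_algebra.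
From mathcomp Require Import all_classical.
From mathcomp Require Import zify ring.

Set Implicit Arguments.
Unset Strict Implicit.
Unset Printing Implicit Defensive.

Import GRing.Theory.

(** * Non-increasing words with bounded multiplicities *)

Lemma geq_trans : transitive geq.
Proof. by move=> x y z /=; lia. Qed.

(** The block of the largest letter is chosen last and put in front, so the recursion follows the
    expansion of a product of geometric sums, one factor per letter. *)
Fixpoint mults (mu : nat -> nat) (m : nat) : seq (seq nat) :=
  if m is k.+1 then
    [seq nseq j k ++ s | j <- iota 0 (mu k).+1, s <- mults mu k]
  else [:: [::]].

Lemma multsS mu m :
  mults mu m.+1 = [seq nseq j m ++ s | j <- iota 0 (mu m).+1, s <- mults mu m].
Proof. by []. Qed.

Lemma sorted_nseq_cat j m s :
  all (fun c => c < m) s -> sorted geq (nseq j m ++ s) = sorted geq s.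
Proof.
move=> s_lt; elim: j => //= j <-.
rewrite (path_sortedE geq_trans) all_cat (_ : all _ _) /=; last first.
  by rewrite all_nseq /geq /= leqnn orbT.
by rewrite (sub_all _ s_lt) // => c /= /ltnW.
Qed.

Lemma mem_mults mu m s :
  (s \in mults mu m) =
  sorted geq s && all (fun c => (c < m) && (count_mem c s <= mu c)) s.
Proof.
elim: m s => [|m IH] s.
  by case: s => // c s; rewrite inE /= andbF.
apply/allpairsPdep/idP => [[j [t [+ + ->]]]|/andP[s_sorted /allP s_le]].
  rewrite mem_iota IH /= add0n ltnS => le_j /andP[t_sorted t_le].
  have t_lt : all (fun c => c < m) t by apply: sub_all t_le => c /andP[].
  rewrite sorted_nseq_cat // t_sorted /=; apply/allP => c.
  have m0 : count_mem m t = 0.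
    by apply/count_memPn/negP => /(allP t_lt); rewrite ltnn.
  rewrite mem_cat mem_nseq count_cat count_nseq.
  case: eqVneq => [->|c_m]; first by rewrite /= eqxx m0 mul1n addn0 ltnSn.
  rewrite andbF /= => /(allP t_le) /andP[c_lt c_le].
  by rewrite eq_sym (negPf c_m) mul0n add0n c_le ltnW.
pose t := [seq c <- s | c != m].
have t_lt : all (fun c => c < m) t.
  apply/allP => c; rewrite mem_filter => /andP[c_m /s_le /andP[+ _]].
  by rewrite ltnS leq_eqVlt (negPf c_m).
have t_sorted : sorted geq t by apply: sorted_filter => //; exact: geq_trans.
exists (count_mem m s), t; split.
- rewrite mem_iota add0n ltnS; case: (boolP (m \in s)) => [/s_le/andP[]//|].
  by move/count_memPn => ->.
- rewrite IH t_sorted /=; apply/allP => c c_t; rewrite (allP t_lt _ c_t) /=.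
  move: c_t; rewrite mem_filter => /andP[_ /s_le /andP[_]].
  by apply: leq_trans; rewrite count_filter; apply: sub_count => x /andP[].
(* Pulling the copies of [m] to the front permutes [s]; both words are sorted, so they coincide. *)
- apply: (sorted_eq geq_trans) => //; rewrite ?sorted_nseq_cat //.
    by move=> x y /=; lia.
  rewrite -size_filter -(perm_filterC (pred1 m) s).
  rewrite perm_cat2r; have /all_pred1P <- := filter_all (pred1 m) s.
  by [].
Qed.

(** The tail never contains [m], so counting [m] in the word recovers the length of the leading
    block, and then the tail. *)
Lemma mults_uniq mu m : uniq (mults mu m).
Proof.
elim: m => // m IH; rewrite multsS.
apply: (@allpairs_uniq _ _ _ (fun j s => nseq j m ++ s)) => //.
  exact: iota_uniq.
move=> [i' s'] [j' t'] /allpairsPdep[i [s [_ s_in [-> ->]]]].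
move=> /allpairsPdep[j [t [_ t_in [-> ->]]]] eq_st.
have count0 u : u \in mults mu m -> count_mem m u = 0.
  rewrite mem_mults => /andP[_ /allP u_lt].
  by apply/count_memPn/negP => /u_lt; rewrite ltnn.
have eq_ij : i = j.
  have := congr1 (count_mem m) eq_st.
  by rewrite !count_cat !count_nseq !count0 //= eqxx !mul1n !addn0.
move: eq_st; rewrite eq_ij => /eqP; rewrite eqseq_cat // eqxx /=.
by move/eqP => ->.
Qed.

(** * Words of a given weight *)

Lemma leq_count_uniq (T : eqType) (s : seq T) :
  {in s, forall c, count_mem c s <= 1} -> uniq s.
Proof.
elim: s => //= x s IH count_le; rewrite IH ?andbT.
  have := count_le x (mem_head _ _); rewrite eqxx addnC addn1 ltnS leqn0.
  by move=> /eqP/count_memPn.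
move=> c c_s; have /count_le : c \in x :: s by rewrite inE c_s orbT.
by apply: leq_trans; rewrite leq_addl.
Qed.

(* [al] selects the allowed letters and [a] those that may not be repeated;
   [N] stands for "unbounded" when only sums up to [N] matter. *)
Definition mult_bound (N : nat) (al a : pred nat) (c : nat) : nat :=
  if al c then (if a c then 1 else N) else 0.

Definition wpart (w : nat -> nat) (al a : pred nat) (n : nat) (s : seq nat) :=
  [&& sorted geq s, all al s, uniq [seq c <- s | a c] & sumn (map w s) == n].

Lemma size_le_sumn (w : nat -> nat) (al : pred nat) s :
  (forall c, al c -> 0 < w c) -> all al s -> size s <= sumn (map w s).
Proof.
move=> w_gt0; elim: s => //= c s IH /andP[/w_gt0 c_gt0 /IH]; lia.
Qed.

Lemma mem_le_sumn (w : nat -> nat) s c : c \in s -> w c <= sumn (map w s).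
Proof.
by elim: s => //= d s IH; rewrite inE => /predU1P[->|/IH]; lia.
Qed.

(** Allowed letters have positive weight, so a word of weight at most [N] has at most [N] letters:
    the multiplicity bound [N] excludes nothing, and neither does the alphabet bound [m]. *)
Lemma mem_mults_wpart w (al a : pred nat) N m n s :
    (forall c, al c -> 0 < w c) -> (forall c, w c <= N -> c < m) -> n <= N ->
  (s \in [seq s <- mults (mult_bound N al a) m | sumn (map w s) == n]) =
  wpart w al a n s.
Proof.
move=> w_gt0 w_lt le_nN; rewrite mem_filter mem_mults /wpart /mult_bound.
case: (sorted geq s) => /=; last by rewrite andbF.
rewrite andbC; apply/andP/and3P => [[/allP s_le ->]|[/allP s_al s_uniq s_sum]].
  split=> //.
    apply/allP => c c_s; have /andP[_] := s_le c c_s.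
    by case: (al c); rewrite // leqn0 => /eqP/count_memPn; rewrite c_s.
  apply: leq_count_uniq => c; rewrite mem_filter => /andP[ac c_s].
  have /andP[_] := s_le c c_s; rewrite ac count_filter => le_c.
  apply: leq_trans (leq_trans (sub_count _ _) le_c) _.
    by move=> x /andP[].
  by case: ifP.
split=> //; apply/allP => c c_s; rewrite s_al //.
have s_N : sumn (map w s) <= N by rewrite (eqP s_sum).
rewrite w_lt ?(leq_trans (mem_le_sumn w c_s)) //=; case: ifP => [ac|_].
  have /(count_uniq_mem c) := s_uniq; rewrite count_filter.
  rewrite (eq_count (a2 := pred1 c)) => [->|x /=]; first exact: leq_b1.
  by case: eqP => // ->.
apply: leq_trans (count_size _ _) (leq_trans _ s_N).
by apply: size_le_sumn w_gt0 _; apply/allP.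
Qed.

Lemma card_bseq_map (T : finType) (g : T -> nat) n (L : seq (seq nat)) :
    injective g -> uniq L ->
    {in L, forall l, size l <= n /\ {in l, forall c, exists x, g x = c}} ->
  #|[set s : {bseq n of T} | map g s \in L]%SET| = size L.
Proof.
move=> g_inj L_uniq L_im.
rewrite cardE -(size_map (fun s : {bseq n of T} => map g s)); apply: perm_size.
apply: uniq_perm => //.
  rewrite map_inj_uniq ?enum_uniq // => s t /(inj_map g_inj); exact: val_inj.
move=> l; apply/mapP/idP => [[s]|l_L].
  by rewrite mem_enum inE => + ->.
have [l_size l_im] := L_im l l_L.
have [s gs] : exists s, map g s = l.
  elim: l l_im {l_L l_size} => [|c l IH] l_im; first by exists [::].
  have [x gx] := l_im c (mem_head _ _).
  have [d d_l|s gs] := IH; first by apply: l_im; rewrite inE d_l orbT.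
  by exists (x :: s); rewrite /= gx gs.
have s_size : size s <= n by rewrite -(size_map g) gs.
by exists (Bseq s_size); rewrite ?mem_enum ?inE /= gs.
Qed.

(** The predicate [Q] makes room for the parity of the number of parts, which separates [a_even]
    from [a_odd]. *)
Lemma card_wpart (T : finType) (g : T -> nat) w (al a : pred nat) N m n
    (Q : pred (seq nat)) :
    injective g -> (forall c, w c <= n -> exists x, g x = c) ->
    (forall c, al c -> 0 < w c) -> (forall c, w c <= N -> c < m) -> n <= N ->
  #|[set s : {bseq n of T} | wpart w al a n (map g s) && Q (map g s)]%SET| =
  count Q [seq s <- mults (mult_bound N al a) m | sumn (map w s) == n].
Proof.
move=> g_inj g_im w_gt0 w_lt le_nN; set L := [seq _ <- _ | _].
have LE s : (s \in [seq s <- L | Q s]) = wpart w al a n s && Q s.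
  by rewrite mem_filter andbC mem_mults_wpart.
rewrite -size_filter -(card_bseq_map (n := n) g_inj).
- by apply: eq_card => s; rewrite !inE LE.
- by rewrite !filter_uniq // mults_uniq.
- move=> s; rewrite LE => /andP[/and4P[_ s_al _ /eqP s_sum] _]; split.
    by rewrite -s_sum; exact: size_le_sumn s_al.
  by move=> c c_s; apply: g_im; rewrite -s_sum; exact: mem_le_sumn.
Qed.

(** * The three kinds of partitions as words *)

(* [code] turns [cgeq] into [geq].  An overlined first occurrence thus gets the
   odd code just above the even code of its plain copies, so overpartitions are
   the non-increasing words without repeated odd letter. *)
Definition code (x : nat * bool) : nat := x.1.*2 + x.2.
Definition decode (c : nat) : nat * bool := (c./2, odd c).

Lemma codeK : cancel code decode.
Proof. by move=> [k b]; rewrite /decode /code /=; congr pair; lia. Qed.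

Lemma unzip1_decode l : unzip1 (map decode l) = map half l.
Proof. by rewrite /unzip1 -map_comp. Qed.

Lemma unzip2_decode l : unzip2 (map decode l) = map odd l.
Proof. by rewrite /unzip2 -map_comp. Qed.

(** Testing [a] on the later letter alone suffices, since equal letters are selected together. *)
Lemma pairwise_uniq_filter (a : pred nat) l :
  pairwise (fun c d => a d ==> (c != d)) l = uniq [seq c <- l | a c].
Proof.
elim: l => //= c l ->; case: ifP => [ac|ac] /=; last first.
  rewrite (_ : all _ _) //; apply/allP => d _; apply/implyP => ad.
  by apply: contraFneq ac => ->.
congr andb; rewrite mem_filter ac /=.
apply/allP/negP => [a_l /a_l|c_l d d_l]; first by rewrite ac eqxx.
by apply/implyP => _; apply/eqP => cd; rewrite cd in c_l.
Qed.

(** An entry is the first occurrence of its part exactly when no earlier entry has the same half. *)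
Lemma first_occurrencesE l :
  [forall i : 'I_(size (map decode l)),
     (nth false (map odd l) i) ==>
       (index (nth 0 (map half l) i) (map half l) == i)] =
  pairwise (fun c d => odd d ==> (c./2 != d./2)) l.
Proof.
apply/forallP/(pairwiseP 0) => [first_l i j|pw [i]] /=.
  rewrite ?unfold_in /= => i_l j_l lt_ij; apply/implyP => odd_j.
  have j_l' : j < size (map decode l) by rewrite size_map.
  have := first_l (Ordinal j_l'); rewrite /= !(nth_map 0) // odd_j /=.
  move=> /eqP idx_j; apply: contraL lt_ij => /eqP eq_ij.
  rewrite -leqNgt -{1}idx_j -eq_ij -(nth_map 0 0) //.
  by apply: index_nth; rewrite size_map.
rewrite size_map => i_l; apply/implyP; rewrite (nth_map 0) // => odd_i.
set k := index _ _.
have le_ki : k <= i by apply: index_nth; rewrite size_map.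
have k_l := leq_ltn_trans le_ki i_l.
have : nth 0 (map half l) k = nth 0 (map half l) i.
  by apply: nth_index; apply: mem_nth; rewrite size_map.
rewrite !(nth_map 0) // => eq_ki; rewrite eqn_leq le_ki leqNgt.
apply/negP => lt_ki; have := pw k i; move=> /(_ k_l i_l lt_ki).
by rewrite odd_i eq_ki eqxx.
Qed.

Lemma is_pod_partitionE n l :
  is_pod_partition n l = wpart id (ltn 0) odd n l.
Proof.
rewrite /is_pod_partition /is_partition /wpart map_id -!andbA.
by congr [&& _, _ & _]; rewrite andbC.
Qed.

Lemma is_overpartitionE n l :
  is_overpartition n (map decode l) = wpart half (ltn 1) odd n l.
Proof.
rewrite /is_overpartition /is_partition /wpart unzip1_decode unzip2_decode.
rewrite first_occurrencesE -!pairwise_uniq_filter all_map.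
have -> : all (preim half (ltn 0)) l = all (ltn 1) l.
  by apply: eq_all => c; rewrite /= half_gt0.
(* The comparison can now be made for a single pair, [c] before [d]. For even [d], [c./2 >= d./2]
   means [c >= d]; for odd [d], [c./2 > d./2] means [c > d]. *)
rewrite !(sorted_pairwise geq_trans) pairwise_map.
suff E : pairwise (relpre half geq) l &&
    pairwise (fun c d => odd d ==> (c./2 != d./2)) l =
  pairwise geq l && pairwise (fun c d => odd d ==> (c != d)) l.
  by case: (all _ _); case: (_ == n); rewrite /= ?andbT ?andbF.
rewrite -!pairwise_relI; apply: eq_pairwise => c d /=; lia.
Qed.

(** Codes 0 and 1 would be parts of size zero; the second condition rules out codes congruent to 3
    modulo 4, the second colour of an odd part. *)
Definition coloured_code (c : nat) := (1 < c) && (odd c./2 ==> ~~ odd c).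

Lemma is_coloured_partitionE n l :
  is_coloured_partition n (map decode l) = wpart half coloured_code pred0 n l.
Proof.
rewrite /is_coloured_partition /is_partition /wpart unzip1_decode !all_map.
rewrite filter_pred0 sorted_map.
have -> : sorted (relpre decode cgeq) l = sorted geq l.
  by case: l => //= c l; apply: eq_path => x y; rewrite /cgeq /=; lia.
have -> : all coloured_code l =
    all (ltn 1) l && all (fun c => odd c./2 ==> ~~ odd c) l.
  by rewrite -all_predI; apply: eq_all.
have -> : all (preim half (ltn 0)) l = all (ltn 1) l.
  by apply: eq_all => c; rewrite /= half_gt0.
case s_l : (sorted geq l) => //=.
rewrite (_ : sorted geq (map half l)) /=; last first.
  rewrite sorted_map; apply: sub_sorted s_l => c d /=; exact: half_leq.
by rewrite -!andbA; congr andb; rewrite andbC.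
Qed.

(** * Generating functions of words *)

Local Open Scope ring_scope.

Lemma sum_mults (R : comNzRingType) (t : nat -> R) mu m :
  \sum_(s <- mults mu m) \prod_(c <- s) t c =
  \prod_(c < m) \sum_(j < (mu c).+1) t c ^+ j.
Proof.
elim: m => [|m IH]; first by rewrite big_seq1 big_ord0 big_nil.
have idx : iota 0 (mu m).+1 = index_iota 0 (mu m).+1.
  by rewrite /index_iota subn0.
rewrite [RHS]big_ord_recr [RHS]/= -IH big_distrr [RHS]/=.
rewrite multsS idx big_allpairs_dep big_mkord.
apply: eq_bigr => j _; rewrite big_distrl /=; apply: eq_bigr => s _.
by rewrite big_cat /= big_nseq -GRing.iter_mulr_1 mulrC.
Qed.

(** The scalar [z] marks the number of letters: 1 counts words, -1 counts them with the sign of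
    their length. *)
Definition gf (z : int) (w mu : nat -> nat) (m : nat) : {poly int} :=
  \prod_(c < m) \sum_(j < (mu c).+1) (z *: 'X^(w c)) ^+ j.

Lemma coef_gf z w mu m i :
  (gf z w mu m)`_i =
  \sum_(s <- [seq s <- mults mu m | sumn (map w s) == i]) z ^+ size s.
Proof.
rewrite /gf -(sum_mults (fun c => z *: 'X^(w c))).
rewrite (eq_bigr (fun s => z ^+ size s *: 'X^(sumn (map w s)))).
  by rewrite coef_sumMXn big_filter.
move=> s _; elim: s => [|c s IH]; first by rewrite big_nil scale1r.
by rewrite big_cons IH /= exprS exprD -scalerAl -scalerAr scalerA.
Qed.

Lemma sum1_seq (T : Type) (L : seq (seq T)) :
  \sum_(s <- L) 1 ^+ size s = (size L)%:Z.
Proof.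
elim: L => [|s L IH]; first by rewrite big_nil.
by rewrite big_cons IH expr1n -intS.
Qed.

Lemma sum_sign_seq (T : Type) (L : seq (seq T)) :
  \sum_(s <- L) (-1) ^+ size s =
  (count (fun s => ~~ odd (size s)) L)%:Z -
  (count (fun s => odd (size s)) L)%:Z.
Proof.
elim: L => [|s L IH]; first by rewrite big_nil.
by rewrite big_cons IH -signr_odd /=; case: (odd _) => /=; lia.
Qed.

(** * The three counting functions as coefficients *)

Section Counts.

Variables (N n : nat) (le_nN : (n <= N)%N).

Lemma pod_gf :
  (pod n)%:Z = (gf 1 id (mult_bound N (ltn 0%N) odd) N.+1)`_n.
Proof.
rewrite coef_gf sum1_seq -count_predT; congr Posz.
rewrite -(card_wpart (T := 'I_n.+1) (g := val)) //.
- by apply: eq_card => s; rewrite !inE is_pod_partitionE andbT.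
- by move=> c le_cn; exists (Ordinal (le_cn : c < n.+1)%N).
Qed.

Definition ord_code (x : 'I_n.+1 * bool) := code (val x.1, x.2).

Lemma ord_code_inj : injective ord_code.
Proof.
move=> [x b] [y c] /(can_inj codeK) [xy ->].
by congr pair; apply: val_inj.
Qed.

Lemma ord_code_surj c : (c./2 <= n)%N -> exists x, ord_code x = c.
Proof.
move=> le_cn; exists (Ordinal (le_cn : c./2 < n.+1)%N, odd c).
by rewrite /ord_code /code /=; lia.
Qed.

Lemma map_ord_code (s : seq ('I_n.+1 * bool)) :
  [seq (val x.1, x.2) | x <- s] = map decode (map ord_code s).
Proof. by rewrite -map_comp; apply: eq_map => x /=; rewrite codeK. Qed.

(** The alphabet bound [N.+1.*2] admits exactly the codes of parts of size at most [N], two for each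
    size. *)
Lemma overp_gf :
  (overp n)%:Z = (gf 1 half (mult_bound N (ltn 1%N) odd) N.+1.*2)`_n.
Proof.
rewrite coef_gf sum1_seq -count_predT; congr Posz.
rewrite -(card_wpart (g := ord_code)) //=.
- by apply: eq_card => s; rewrite !inE map_ord_code is_overpartitionE andbT.
- exact: ord_code_inj.
- exact: ord_code_surj.
- by move=> c; rewrite half_gt0.
- by move=> c; lia.
Qed.

Lemma A_gf :
  A n = (gf (-1) half (mult_bound N coloured_code pred0) N.+1.*2)`_n.
Proof.
have w_gt0 c : coloured_code c -> (0 < c./2)%N.
  by rewrite half_gt0 => /andP[].
have w_lt c : (c./2 <= N -> c < N.+1.*2)%N by lia.
have card_coloured Q := @card_wpart _ ord_code half coloured_code pred0
  N N.+1.*2 n Q ord_code_inj ord_code_surj w_gt0 w_lt le_nN.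
rewrite coef_gf sum_sign_seq -!card_coloured.
rewrite /A; congr (_%:Z - _%:Z); apply: eq_card => s;
by rewrite !inE map_ord_code is_coloured_partitionE !size_map.
Qed.

End Counts.

(** * Polynomials modulo a power of X *)

Section Truncation.

Variable R : comNzRingType.
Implicit Types p q r : {poly R}.

Lemma take_polyM N p q : take_poly N (p * q) = take_poly N (take_poly N p * q).
Proof.
rewrite -[in LHS](poly_take_drop N p) mulrDl take_polyD mulrAC.
by rewrite take_polyMXn_0 addr0.
Qed.

Lemma eq_take_polyM N p p' q q' :
  take_poly N p = take_poly N p' -> take_poly N q = take_poly N q' ->
  take_poly N (p * q) = take_poly N (p' * q').
Proof.
move=> pp' qq'; transitivity (take_poly N (p' * q)).
  by rewrite take_polyM pp' -take_polyM.
by rewrite ![p' * _]mulrC take_polyM qq' -take_polyM.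
Qed.

Lemma eq_take_poly_prod N (I : eqType) (r : seq I) (P : pred I)
    (F G : I -> {poly R}) :
  (forall i, i \in r -> P i -> take_poly N (F i) = take_poly N (G i)) ->
  take_poly N (\prod_(i <- r | P i) F i) =
  take_poly N (\prod_(i <- r | P i) G i).
Proof.
move=> FG; rewrite big_seq_cond [in RHS]big_seq_cond.
apply: (big_ind2 (fun p q => take_poly N p = take_poly N q)) => //.
- by move=> p p' q q'; exact: eq_take_polyM.
- by move=> i /andP[]; exact: FG.
Qed.

Lemma take_poly_Mreg N p q r :
  r`_0 = 1 -> take_poly N (p * r) = take_poly N (q * r) ->
  take_poly N p = take_poly N q.
Proof.
move=> r0 pq; suff coef_pq i : (i < N)%N -> p`_i = q`_i.
  by apply/polyP => i; rewrite !coef_take_poly; case: ifP => // /coef_pq.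
elim/ltn_ind: i => i IH lt_iN; have := congr1 (fun p => p`_i) pq.
rewrite !coef_take_poly lt_iN !coefM !big_ord_recr /= subnn r0 !mulr1.
rewrite (eq_bigr (fun j : 'I_i => q`_j * r`_(i - j))) => [/addrI //|j _].
by rewrite IH ?ltn_ord // (ltn_trans (ltn_ord j)).
Qed.

Lemma take_poly_geometric N (z : R) k : (0 < k)%N ->
  take_poly N.+1 ((\sum_(j < N.+1) (z *: 'X^k) ^+ j) * (1 - z *: 'X^k)) =
  take_poly N.+1 1.
Proof.
move=> k_gt0; rewrite mulrC -opprB mulNr -subrX1 opprB.
rewrite -scaleN1r take_polyD take_polyZ exprZn -exprM.
(* Telescoping leaves the single error term of degree [k * N.+1], which is at least [N.+1] because
   [k] is positive. *)
have -> : (k * N.+1)%N = (k.-1 * N.+1 + N.+1)%N by nia.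
by rewrite exprD take_polyZ take_polyMXn_0 !scaler0 addr0.
Qed.

Lemma take_poly_1BXn N k :
  (N <= k)%N -> take_poly N (1 - 'X^k : {poly R}) = take_poly N 1.
Proof.
move=> le_Nk; rewrite -scaleN1r take_polyD take_polyZ -(subnK le_Nk) exprD.
by rewrite take_polyMXn_0 scaler0 addr0.
Qed.

Lemma prod_even_index N (F : nat -> {poly R}) :
  \prod_(1 <= k < N.*2.+1 | ~~ odd k) F k = \prod_(1 <= k < N.+1) F k.*2.
Proof.
elim: N => [|N IH]; first by rewrite !big_nil.
rewrite [RHS]big_nat_recr //= -IH big_mkcond [in RHS]big_mkcond doubleS.
by rewrite 2?big_nat_recr //= odd_double /= mulr1.
Qed.

End Truncation.

(** * The product identity, factor by factor *)

Section Identity.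

Variable N : nat.

Let tr (p : {poly int}) := take_poly N.+1 p.
Let even_part (p : {poly int}) k := if odd k then 1 else p.

Lemma prod_double_index (F : nat -> {poly int}) m :
  \prod_(c < m.*2) F c = \prod_(k < m) (F k.*2 * F k.*2.+1).
Proof.
elim: m => [|m IH]; first by rewrite !big_ord0.
by rewrite doubleS !big_ord_recr /= IH mulrA.
Qed.

Lemma drop_factor0 (F : nat -> {poly int}) :
  F 0%N = 1 -> \prod_(k < N.+1) F k = \prod_(1 <= k < N.+1) F k.
Proof. by move=> F0; rewrite -(big_mkord xpredT) [LHS]big_ltn // F0 mul1r. Qed.

(* Euler's theorem in the variable X^2: the product of the two factors is
   [\prod_k (1 - X^(2 k))], whose factors with [2 k > N] are invisible. *)
Lemma euler_truncated :
  tr (\prod_(1 <= k < N.+1)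
        ((if odd k then 1 - 'X^(k.*2) else 1 + 'X^k) * even_part (1 - 'X^k) k))
  = tr (\prod_(1 <= k < N.+1) even_part (1 - 'X^k) k).
Proof.
rewrite (eq_bigr (fun k => 1 - 'X^(k.*2))); last first.
  move=> k _; rewrite /even_part; case: ifP => _; first by rewrite mulr1.
  by rewrite -addnn exprD; ring.
rewrite -(prod_even_index N (fun k => 1 - 'X^k)) big_mkcond /=.
rewrite (@big_cat_nat _ _ _ N.+1) //=; last by lia.
rewrite -[RHS]/(take_poly _ _) -[X in _ = take_poly _ X]mulr1.
apply: eq_take_polyM.
  by congr take_poly; apply: eq_bigr => k _; rewrite /even_part if_neg.
transitivity (tr (\prod_(N.+1 <= k < N.*2.+1) 1)); last by rewrite big1_eq.
apply: eq_take_poly_prod => k; rewrite mem_index_iota => /andP[lt_Nk _] _.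
by case: ifP => // _; apply: take_poly_1BXn.
Qed.

Let podF k : {poly int} :=
  \sum_(j < (mult_bound N (ltn 0%N) odd k).+1) (1 *: 'X^k) ^+ j.
Let overF c : {poly int} :=
  \sum_(j < (mult_bound N (ltn 1%N) odd c).+1) (1 *: 'X^(c./2)) ^+ j.
Let colF c : {poly int} :=
  \sum_(j < (mult_bound N coloured_code pred0 c).+1) (-1 *: 'X^(c./2)) ^+ j.

Let den k : {poly int} := (1 - 'X^k) * even_part (1 + 'X^k) k.

(** For odd [k] the factor [1 + X^k] meets [1 - X^k]; for even [k] the geometric sum cancels
    [1 - X^k] and leaves [1 + X^k]. *)
Lemma pod_factor k : (0 < k)%N ->
  tr (podF k * den k) = tr (if odd k then 1 - 'X^(k.*2) else 1 + 'X^k).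
Proof.
move=> k_gt0; rewrite /podF /den /mult_bound /even_part /= k_gt0.
case: ifP => _.
  rewrite 2!big_ord_recr big_ord0 /= -addnn exprD scale1r.
  by congr take_poly; ring.
rewrite mulrA -[1 + _ in RHS]mul1r; apply: eq_take_polyM => //.
by rewrite -[X in 1 - X]scale1r take_poly_geometric.
Qed.

(** Codes [2k] and [2k+1] both have weight [k]. Up to truncation the overpartition pair is
    [(1 + X^k) / (1 - X^k)], and the coloured pair is [1 / (1 + X^k)] for odd [k] and its square for
    even [k]; [den k] cancels what remains. *)
Lemma pairs_factor k : (0 < k)%N ->
  tr (colF k.*2 * colF k.*2.+1 * (overF k.*2 * overF k.*2.+1) * den k) = tr 1.
Proof.
move=> k_gt0; have gt1 : (1 < k.*2)%N by lia.
have gt1S : (1 < k.*2.+1)%N by lia.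
rewrite /colF /overF /den /mult_bound /even_part /coloured_code /= gt1 gt1S.
rewrite uphalf_double doubleK odd_double /= implybT implybF.
set Sm := \sum_(j < N.+1) (-1 *: _) ^+ j.
set Sp := \sum_(j < N.+1) (1 *: _) ^+ j.
have Sm1 : tr (Sm * (1 + 'X^k)) = tr 1.
  have -> : 1 + 'X^k = 1 - -1 *: 'X^k :> {poly int} by rewrite scaleN1r opprK.
  exact: take_poly_geometric.
have Sp1 : tr (Sp * (1 - 'X^k)) = tr 1.
  by rewrite -[X in 1 - X]scale1r; apply: take_poly_geometric.
have SmSp : tr ((Sm * (1 + 'X^k)) * (Sp * (1 - 'X^k))) = tr 1.
  by rewrite -[1 in RHS]mulr1; apply: eq_take_polyM.
case: (odd k) => /=; rewrite -?/Sm !big_ord_recr !big_ord0 /= scale1r.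
  by rewrite -SmSp; congr take_poly; ring.
transitivity (tr ((Sm * (1 + 'X^k)) * ((Sm * (1 + 'X^k)) * (Sp * (1 - 'X^k))))).
  by congr take_poly; ring.
by rewrite -[1 in RHS]mulr1; apply: eq_take_polyM.
Qed.

Lemma gf_identity :
  tr (gf 1 id (mult_bound N (ltn 0%N) odd) N.+1) =
  tr (gf (-1) half (mult_bound N coloured_code pred0) N.+1.*2 *
      gf 1 half (mult_bound N (ltn 1%N) odd) N.+1.*2).
Proof.
have sum1 (t : {poly int}) : \sum_(j < 1) t ^+ j = 1 by rewrite big_ord1.
pose E := \prod_(1 <= k < N.+1) even_part (1 - 'X^k) k.
pose D := \prod_(1 <= k < N.+1) den k.
have coef0_1BXn k : (0 < k)%N -> (1 - 'X^k : {poly int})`_0 = 1.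
  by rewrite coefB coef1 coefXn; case: k.
have coef0_1DXn k : (0 < k)%N -> (1 + 'X^k : {poly int})`_0 = 1.
  by rewrite coefD coef1 coefXn; case: k.
(* [D] clears denominators. The extra factor [E] allows Euler's theorem to be used in the form
   [euler_truncated], without inverting anything: both sides become [E]. *)
apply: (@take_poly_Mreg _ _ _ _ (D * E)).
  rewrite coef0M !coef0_prod !big_nat !big1 // => k /andP[k_gt0 _].
    by rewrite /even_part; case: ifP; rewrite ?coef1 ?coef0_1BXn.
  rewrite /den /even_part coef0M coef0_1BXn // mul1r.
  by case: ifP; rewrite ?coef1 ?coef0_1DXn.
transitivity (tr E).
  rewrite -euler_truncated big_split /= !mulrA; apply: eq_take_polyM => //.
  rewrite /gf (drop_factor0 (F := podF)) ?/podF ?sum1 // -big_split /=.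
  apply: eq_take_poly_prod => k.
  by rewrite mem_index_iota => /andP[k_gt0 _] _; exact: pod_factor.
rewrite -[E in LHS]mul1r mulrA; apply: eq_take_polyM => //.
rewrite /gf (prod_double_index colF) (prod_double_index overF) -big_split /=.
(* Codes 0 and 1 are not allowed letters, so their sums have only the term of exponent 0 and the
   pair at index 0 is 1. *)
rewrite (drop_factor0
  (F := fun k => colF k.*2 * colF k.*2.+1 * (overF k.*2 * overF k.*2.+1)));
  last by rewrite /colF /overF !sum1 !mulr1.
rewrite -big_split /=.
transitivity (tr (\prod_(1 <= k < N.+1) 1)); first by rewrite big1_eq.
symmetry; apply: eq_take_poly_prod => k.
by rewrite mem_index_iota => /andP[k_gt0 _] _; exact: pairs_factor.
Qed.

End Identity.

(** * From the product identity to the convolution *)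

Local Open Scope classical_set_scope.

Theorem theorem4p6 (n : nat) :
  (pod n)%:Z = \sum_(j \in [set: nat]) A j * (overp (n%:Z - j%:Z))%:Z.
Proof.
(* The terms with [j > n] vanish because [overp] is 0 at negative arguments; the predecessor below
   appears since [Negz m] is [-(m + 1)]. *)
rewrite -(@fsbig_widen _ _ _ _ `I_n.+1) //; last first.
  move=> j [_ /= /negP]; rewrite -leqNgt => lt_nj.
  suff -> : overp (n%:Z - j%:Z) = 0%N by rewrite mulr0.
  by have -> : n%:Z - j%:Z = Negz (j - n).-1 by lia.
(* Taking [N] equal to [n] serves all indices involved, as [j] and [n - j] are both at most [n]. *)
rewrite -fsbig_ord (pod_gf (leqnn n)).
have := congr1 (fun p : {poly int} => p`_n) (gf_identity n).
rewrite !coef_take_poly ltnSn coefM => ->; apply: eq_bigr => j _.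
have le_jn : (j <= n)%N by rewrite -ltnS.
by rewrite (A_gf le_jn) subzn // (overp_gf (leq_subr j n)).
Qed.
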